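(* Let $T$ be a self-adjoint, bicomplex compact operator on a separable infinite dimensional bicomplex Hilbert space $M$. Then there exists in $M$ an orthonormal (Schauder) $\mathbb{M}(2)$-basis $\{|\psi_n\rangle\}_{n\ge 1}$ consisting of eigenkets for $T$. Moreover, for every $|\phi\rangle\in M$, $$T(|\phi\rangle)=\sum_{n=1}^{\infty}\lambda_n\,(|\psi_n\rangle,|\phi\rangle)\,|\psi_n\rangle,$$ or, in bra-ket notation, $T=\sum_{n=1}^{\infty}\lambda_n|\psi_n\rangle\langle\psi_n|$, where $\lambda_n\in\mathbb{M}(2)$ is the eigenvalue corresponding to $|\psi_n\rangle$.
   Context: Bicomplex numbers: $\mathbb{M}(2)=\{z_1+z_2\mathbf{i_2} : z_1,z_2\in\mathbb{C}(\mathbf{i_1})\}$ is the commutative ring where $\mathbf{i_1}^2=\mathbf{i_2}^2=-1$, $\mathbf{i_1}\mathbf{i_2}=\mathbf{i_2}\mathbf{i_1}=:\mathbf{j}$ (so $\mathbf{j}^2=1$), and $\mathbb{C}(\mathbf{i_1})=\{x+y\mathbf{i_1}:x,y\in\mathbb{R}\}$. Put $\mathbf{e_1}=(1+\mathbf{j})/2$, $\mathbf{e_2}=(1-\mathbf{j})/2$; these are idempotents with $\mathbf{e_1}+\mathbf{e_2}=1$, $\mathbf{e_1}\mathbf{e_2}=0$. Each $w=z_1+z_2\mathbf{i_2}$ is uniquely $w=P_1(w)\mathbf{e_1}+P_2(w)\mathbf{e_2}$ with $P_1(w)=z_1-z_2\mathbf{i_1}$, $P_2(w)=z_1+z_2\mathbf{i_1}$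 in $\mathbb{C}(\mathbf{i_1})$. The conjugation $\dagger_3$ is $w^{\dagger_3}=\bar z_1-\bar z_2\mathbf{i_2}=\overline{P_1(w)}\mathbf{e_1}+\overline{P_2(w)}\mathbf{e_2}$. Let $\mathbb{D}_+=\{x_1\mathbf{e_1}+x_2\mathbf{e_2}: x_1,x_2\in\mathbb{R},\ x_1,x_2\ge 0\}$. Bicomplex Hilbert space: let $M$ be an $\mathbb{M}(2)$-module; its elements are called kets. A bicomplex scalar product on $M$ is a map $(\cdot,\cdot):M\times M\to\mathbb{M}(2)$ that is additive in the second argument and satisfies $(|\psi\rangle,s|\phi\rangle)=s(|\psi\rangle,|\phi\rangle)$ for $s\in\mathbb{M}(2)$, $(|\psi\rangle,|\phi\rangle)=(|\phi\rangle,|\psi\rangle)^{\dagger_3}$, $(|\psi\rangle,|\psi\rangle)=0\Leftrightarrow|\psi\rangle=0$, and $(|\psi\rangle,|\psi\rangle)\in\mathbb{D}_+$. Put $V_k=\mathbf{e_k}M$ and $|\psi_{\mathbf k}\rangle=\mathbf{e_k}|\psi\rangle$, $k=1,2$. Each $V_k$ is a vector space over $\mathbb{C}(\mathbf{i_1})$ with (standard) scalar product $(\cdot,\cdot)_{\widehat k}=P_k((\cdot,\cdot))$, and $M=V_1\oplus V_2$. The norm is $\||\psi\rangle\|=\frac{1}{\sqrt2}\sqrt{(|\psi_{\mathbf 1}\rangle,|\psi_{\mathbf 1}\rangle)_{\widehat 1}+(|\psi_{\mathbf 2}\rangle,|\psi_{\mathbf 2}\rangle)_{\widehat 2}}$.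 $M$ is a bicomplex Hilbert space if it is complete for this norm (equivalently $V_1$ and $V_2$ are Hilbert spaces). ''Separable infinite dimensional'' is understood as: $V_1$ and $V_2$ are both separable infinite dimensional complex Hilbert spaces (equivalently, $M$ is isometrically isomorphic to the bicomplex analogue of $\ell^2$). A bicomplex linear operator is an $\mathbb{M}(2)$-linear map $T:M\to M$. It is a bicomplex compact operator if for every bounded sequence $\{|\phi_n\rangle\}$ in $M$ the sequence $\{T(|\phi_n\rangle)\}$ has a convergent subsequence. It is self-adjoint if $(|\psi\rangle,T|\phi\rangle)=(T|\psi\rangle,|\phi\rangle)$ for all $|\psi\rangle,|\phi\rangle\in M$. A sequence $\{|\psi_n\rangle\}$ is an orthonormal Schauder $\mathbb{M}(2)$-basis if $(|\psi_n\rangle,|\psi_m\rangle)=\delta_{nm}$ and every $|\psi\rangle\in M$ can be written as a norm-convergent series $\sum_{n=1}^\infty w_n|\psi_n\rangle$ with $w_n\in\mathbb{M}(2)$. An eigenket of $T$ with eigenvalue $\lambda\in\mathbb{M}(2)$ is a nonzero $|\psi\rangle\in M$ with $T|\psi\rangle=\lambda|\psi\rangle$. The operator $|\psi_n\rangle\langle\psi_n|$ maps $|\phi\rangle$ to $(|\psi_n\rangle,|\phi\rangle)|\psi_n\rangle$, and the series for $T$ is understood as convergent on each ket. *)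

(* Defs.v *)
From HB Require Import structures.
From mathcomp Require Import all_boot all_order all_algebra.
From mathcomp Require Import complex.
From mathcomp Require Import all_classical all_reals all_analysis.
From mathcomp Require Import ring.

Set Implicit Arguments.
Unset Strict Implicit.
Unset Printing Implicit Defensive.

Import Order.TTheory GRing.Theory Num.Theory.
Import numFieldNormedType.Exports.

Local Open Scope classical_set_scope.
Local Open Scope ring_scope.

(* [Bicomplex z1 z2] stands for z1 + z2 * i2, and R[i] for C(i1). *)
Record bicomplex (R : realType) := Bicomplex { bc1 : R[i]; bc2 : R[i] }.

Section BicomplexRing.
Variable R : realType.
Implicit Types u v w : bicomplex R.

Definition bc_pair w := (bc1 w, bc2 w).
Definition pair_bc (p : R[i] * R[i]) := Bicomplex p.1 p.2.

Lemma bc_pairK : cancel bc_pair pair_bc.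
Proof. by case. Qed.

HB.instance Definition _ := Choice.copy (bicomplex R) (can_type bc_pairK).

Definition bc_zero : bicomplex R := Bicomplex 0 0.
Definition bc_opp w : bicomplex R := Bicomplex (- bc1 w) (- bc2 w).
Definition bc_add u v : bicomplex R :=
  Bicomplex (bc1 u + bc1 v) (bc2 u + bc2 v).
Definition bc_one : bicomplex R := Bicomplex 1 0.
Definition bc_mul u v : bicomplex R :=
  Bicomplex (bc1 u * bc1 v - bc2 u * bc2 v) (bc1 u * bc2 v + bc2 u * bc1 v).

Lemma bc_addA : associative bc_add.
Proof. by move=> u v w; rewrite /bc_add /= !addrA. Qed.
Lemma bc_addC : commutative bc_add.
Proof. by move=> u v; congr Bicomplex; rewrite addrC. Qed.
Lemma bc_add0 : left_id bc_zero bc_add.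
Proof. by case=> a b; rewrite /bc_add /= !add0r. Qed.
Lemma bc_addN : left_inverse bc_zero bc_opp bc_add.
Proof. by move=> w; rewrite /bc_add /= !addNr. Qed.

HB.instance Definition _ := GRing.isZmodule.Build (bicomplex R)
  bc_addA bc_addC bc_add0 bc_addN.

Lemma bc_mulA : associative bc_mul.
Proof. by move=> u v w; rewrite /bc_mul /=; congr Bicomplex; ring. Qed.
Lemma bc_mulC : commutative bc_mul.
Proof. by move=> u v; rewrite /bc_mul /=; congr Bicomplex; ring. Qed.
Lemma bc_mul1 : left_id bc_one bc_mul.
Proof. by case=> a b; rewrite /bc_mul /=; congr Bicomplex; ring. Qed.
Lemma bc_mulDl : left_distributive bc_mul bc_add.
Proof. by move=> u v w; rewrite /bc_mul /bc_add /=; congr Bicomplex; ring. Qed.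
Lemma bc_one_neq0 : bc_one != bc_zero.
Proof. by apply/eqP => -[] /eqP; rewrite oner_eq0. Qed.

HB.instance Definition _ := GRing.Zmodule_isComNzRing.Build (bicomplex R)
  bc_mulA bc_mulC bc_mul1 bc_mulDl bc_one_neq0.

End BicomplexRing.

Section BicomplexNumbers.
Variable R : realType.

Definition bc_of_complex (z : R[i]) : bicomplex R := Bicomplex z 0.
Definition bc_of_real (x : R) : bicomplex R := bc_of_complex x%:C%C.

Definition bi1 : bicomplex R := bc_of_complex 'i%C.
Definition bi2 : bicomplex R := Bicomplex 0 1.
Definition bj : bicomplex R := bi1 * bi2.

(* [bicomplex R] is not a [unitRingType] instance, so 1/2 is taken in R. *)
Definition be1 : bicomplex R := bc_of_real 2^-1 * (1 + bj).
Definition be2 : bicomplex R := bc_of_real 2^-1 * (1 - bj).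

Definition P1 (w : bicomplex R) : R[i] := bc1 w - bc2 w * 'i%C.
Definition P2 (w : bicomplex R) : R[i] := bc1 w + bc2 w * 'i%C.

Definition dagger3 (w : bicomplex R) : bicomplex R :=
  Bicomplex (conjc (bc1 w)) (- conjc (bc2 w)).

Definition Dplus : set (bicomplex R) :=
  [set w | exists x1 x2 : R, [/\ 0 <= x1, 0 <= x2 &
     w = bc_of_real x1 * be1 + bc_of_real x2 * be2]].

Lemma bicomplexE (w : bicomplex R) :
  w = bc_of_complex (bc1 w) + bc_of_complex (bc2 w) * bi2.
Proof. by case: w => a b; congr Bicomplex => /=; ring. Qed.

Lemma bi1_sq : bi1 * bi1 = -1.
Proof.
congr Bicomplex => /=; last by ring.
by rewrite mulr0 subr0 -expr2 sqr_i.
Qed.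

Lemma bi2_sq : bi2 * bi2 = -1.
Proof. by congr Bicomplex => /=; ring. Qed.

Lemma idempotent_decomposition (w : bicomplex R) :
  w = bc_of_complex (P1 w) * be1 + bc_of_complex (P2 w) * be2.
Proof.
have i2 : 'i%C * 'i%C = -1 :> R[i] by rewrite -expr2 sqr_i.
have h2 : (2^-1)%:C%C = 2^-1 :> R[i] by rewrite fmorphV rmorph_nat.
rewrite /be1 /be2 /bc_of_real h2.
case: w => a b; congr Bicomplex => /=; rewrite /P1 /P2 /=.
  by field.
transitivity (- b * ('i%C * 'i%C)); first by rewrite i2; ring.
by field.
Qed.

End BicomplexNumbers.

Arguments bi1 {R}.
Arguments bi2 {R}.
Arguments bj {R}.
Arguments be1 {R}.
Arguments be2 {R}.

Section BicomplexHilbert.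
Variables (R : realType) (M : lmodType (bicomplex R)).
Variable sp : M -> M -> bicomplex R.
Implicit Types (psi phi : M) (u : nat -> M).

Record is_scalar_product : Prop := {
  sp_add : forall psi phi chi, sp psi (phi + chi) = sp psi phi + sp psi chi;
  sp_scale : forall psi phi (s : bicomplex R), sp psi (s *: phi) = s * sp psi phi;
  sp_dagger : forall psi phi, sp psi phi = dagger3 (sp phi psi);
  sp_definite : forall psi, sp psi psi = 0 <-> psi = 0;
  sp_Dplus : forall psi, Dplus (sp psi psi)
}.

Definition V1 : set M := [set be1 *: psi | psi in [set: M]].
Definition V2 : set M := [set be2 *: psi | psi in [set: M]].

(* [P1 (sp psi psi)] and [P2 (sp psi psi)] are nonnegative reals in R[i]
   whenever [sp] is a scalar product; [complex.Re] reads them back in R. *)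
Definition sqnorm1 psi : R := complex.Re (P1 (sp psi psi)).
Definition sqnorm2 psi : R := complex.Re (P2 (sp psi psi)).

Definition norm1 psi : R := Num.sqrt (sqnorm1 psi).
Definition norm2 psi : R := Num.sqrt (sqnorm2 psi).

Definition bcnorm psi : R :=
  (Num.sqrt 2)^-1 * Num.sqrt (sqnorm1 (be1 *: psi) + sqnorm2 (be2 *: psi)).

Definition converges_to u psi : Prop :=
  bcnorm (u n - psi) @[n --> \oo] --> (0 : R).

Definition cauchy_ket u : Prop :=
  forall eps : R, 0 < eps -> exists N : nat, forall m n : nat,
    (N <= m)%N -> (N <= n)%N -> bcnorm (u m - u n) < eps.

Definition is_hilbert : Prop :=
  is_scalar_product /\
  (forall u, cauchy_ket u -> exists psi, converges_to u psi).

Definition separable_for (N : M -> R) (V : set M) : Prop :=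
  exists D : set M, [/\ countable D, D `<=` V &
    forall psi, V psi -> forall eps : R, 0 < eps ->
      exists2 phi, D phi & N (psi - phi) < eps].

(* No finite family in V spans V over C(i1). *)
Definition infinite_dimensional (V : set M) : Prop :=
  forall (n : nat) (v : 'I_n -> M), (forall k, V (v k)) ->
    exists2 psi, V psi &
      forall c : 'I_n -> R[i], psi <> \sum_(k < n) bc_of_complex (c k) *: v k.

Definition is_separable_infdim : Prop :=
  [/\ separable_for norm1 V1, infinite_dimensional V1,
      separable_for norm2 V2 & infinite_dimensional V2].

Definition bounded_ket u : Prop := exists B : R, forall n, bcnorm (u n) <= B.

Definition compact_operator (T : M -> M) : Prop :=
  forall u, bounded_ket u ->
    exists k : nat -> nat, increasing_seq k /\
      exists psi, converges_to (fun n => T (u (k n))) psi.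

Definition self_adjoint (T : M -> M) : Prop :=
  forall psi phi, sp psi (T phi) = sp (T psi) phi.

Definition orthonormal_ket u : Prop :=
  forall n m : nat, sp (u n) (u m) = (n == m)%:R.

Definition orthonormal_schauder_basis u : Prop :=
  orthonormal_ket u /\
  forall psi, exists w : nat -> bicomplex R,
    converges_to (series (fun n => w n *: u n)) psi.

Definition is_eigenket (T : M -> M) (lambda : bicomplex R) psi : Prop :=
  psi <> 0 /\ T psi = lambda *: psi.

End BicomplexHilbert.

(* Main.v *)
(* On M, regarded as a complex vector space, both P1 o sp and P2 o sp are positive semidefinite, and
   T is compact and self-adjoint for each of them.  The spectral theorem holds in the semidefinite
   setting, up to null vectors; multiplying by e1 and e2 kills these, so the two resulting
   sequences a, b glue to the basis e1 a_n + e2 b_n with eigenvalues mu_n e1 + nu_n e2.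

   In the complex case the eigenvectors are chosen greedily: at stage n a target d is picked from a
   dense sequence, each of its terms being used infinitely often, and psi_n is a unit eigenvector
   orthogonal to the previous ones with |<e, d>|^2 <= 2 |<psi_n, d>|^2 for all competitors e.  A
   unit eigenvector e orthogonal to every psi_n would have <e, d> <> 0 for some d, against Bessel's
   inequality for d; hence the orthogonal complement of the psi_n is null. *)
Require Import Defs.
From HB Require Import structures.
From mathcomp Require Import all_boot all_order all_algebra.
From mathcomp Require Import complex.
From mathcomp Require Import all_classical all_reals all_analysis.
From mathcomp Require Import ring lra.

Set Implicit Arguments.
Unset Strict Implicit.
Unset Printing Implicit Defensive.

Import Order.TTheory GRing.Theory Num.Theory.
Local Open Scope ring_scope.

(** Dependent choice with the whole past in view: finite prefixes are extended by a choice function,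
    and the second hypothesis makes validity at [n] depend only on the terms below [n]. *)
Lemma prefix_choice (E : Type) (x0 : E) (P : (nat -> E) -> nat -> E -> Prop) :
  (forall f n, (forall k, (k < n)%N -> P f k (f k)) -> exists e, P f n e) ->
  (forall f g n e, (forall k, (k < n)%N -> f k = g k) -> P f n e -> P g n e) ->
  exists f, forall n, P f n (f n).
Proof.
move=> step ext.
(* Validity of the prefix sits inside the existential, so that [next] is total; [x0] serves for
   invalid prefixes. *)
have /choice[next nextP] : forall fn : (nat -> E) * nat, exists e,
    (forall k, (k < fn.2)%N -> P fn.1 k (fn.1 k)) -> P fn.1 fn.2 e.
  move=> [f n]; have [/step[e ef]|h] := pselect (forall k, (k < n)%N -> P f k (f k)).
    by exists e.
  by exists x0 => /h.
pose fix s n := if n is n'.+1 then rcons (s n') (next (nth x0 (s n'), n')) else [::].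
have sz n : size (s n) = n by elim: n => //= n IH; rewrite size_rcons IH.
have nths n k : (k < n)%N -> nth x0 (s n) k = next (nth x0 (s k), k).
  elim: n => // n IH; rewrite ltnS leq_eqVlt /= nth_rcons sz => /predU1P[->|kn].
    by rewrite ltnn eqxx.
  by rewrite kn IH.
exists (fun n => next (nth x0 (s n), n)); elim/ltn_ind => n IH.
apply: (ext (nth x0 (s n))) => [k kn|]; first exact: nths.
apply: (nextP (nth x0 (s n), n)) => /= k kn; rewrite nths//.
apply: ext (IH k kn) => l lk; rewrite nths//; exact: ltn_trans kn.
Qed.

(** * Compact self-adjoint operators on a semi-inner product space *)

Section SemiInnerProduct.
Variables (R : realType) (V : lmodType R[i]) (ip : V -> V -> R[i]).

(** Semidefinite only: on all of [M], each component of the scalar product vanishes on the other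
    idempotent summand. *)
Record is_semi_ip : Prop := {
  ipDr : forall x y z, ip x (y + z) = ip x y + ip x z;
  ipZr : forall x y c, ip x (c *: y) = c * ip x y;
  ip_conj : forall x y, ip x y = conjc (ip y x);
  ip_ge0 : forall x, 0 <= complex.Re (ip x x)
}.

Definition sqip x : R := complex.Re (ip x x).
Definition csq (c : R[i]) : R := complex.Re c ^+ 2 + complex.Im c ^+ 2.
Local Notation q := sqip.

Hypothesis ipP : is_semi_ip.

Lemma csq_ge0 c : 0 <= csq c.
Proof. by rewrite addr_ge0 ?sqr_ge0. Qed.

Lemma csq_eq0 c : csq c = 0 -> c = 0.
Proof.
case: c => a b; rewrite /csq /= => /eqP.
by rewrite paddr_eq0 ?sqr_ge0// !sqrf_eq0 => /andP[/eqP-> /eqP->].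
Qed.

Lemma csqE c : c * conjc c = (csq c)%:C%C.
Proof. by case: c => a b; congr Complex; rewrite /csq /=; ring. Qed.

Lemma ReD (c d : R[i]) : complex.Re (c + d) = complex.Re c + complex.Re d.
Proof. by case: c d => [? ?] [? ?]. Qed.

Lemma ipBr x y z : ip x (y - z) = ip x y - ip x z.
Proof. by rewrite -[- z]scaleN1r (ipDr ipP) (ipZr ipP) mulN1r. Qed.

Lemma ip0r x : ip x 0 = 0.
Proof. by rewrite -(scale0r x) (ipZr ipP) mul0r. Qed.

Lemma ipDl x y z : ip (x + y) z = ip x z + ip y z.
Proof. by rewrite (ip_conj ipP) (ipDr ipP) rmorphD /= -!(ip_conj ipP). Qed.

Lemma ipBl x y z : ip (x - y) z = ip x z - ip y z.
Proof. by rewrite (ip_conj ipP) ipBr rmorphB /= -!(ip_conj ipP). Qed.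

Lemma ipZl x y c : ip (c *: x) y = conjc c * ip x y.
Proof. by rewrite (ip_conj ipP) (ipZr ipP) rmorphM /= -(ip_conj ipP). Qed.

Lemma ip_sumr (I : Type) (r : seq I) (P : pred I) (F : I -> V) x :
  ip x (\sum_(i <- r | P i) F i) = \sum_(i <- r | P i) ip x (F i).
Proof.
by elim/big_rec2: _ => [|i y1 y2 _ <-]; rewrite ?ip0r// (ipDr ipP).
Qed.

Lemma ip_eq0C x y : ip x y = 0 -> ip y x = 0.
Proof. by rewrite (ip_conj ipP) => /eqP; rewrite conjc_eq0 => /eqP. Qed.

Lemma Re_ipC x y : complex.Re (ip x y) = complex.Re (ip y x).
Proof. by rewrite (ip_conj ipP); case: (ip y x). Qed.

Lemma ipxx x : ip x x = (q x)%:C%C.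
Proof.
rewrite /q; have := ip_conj ipP x x; case: (ip x x) => a b /= [] /eqP.
by rewrite -subr_eq0 opprK -mulr2n mulrn_eq0/= => /eqP->.
Qed.

Lemma sqip_ge0 x : 0 <= q x.
Proof. exact: ip_ge0. Qed.

Lemma sqip0 : q 0 = 0. Proof. by rewrite /q ip0r. Qed.

Lemma sqipD x y : q (x + y) = q x + q y + 2 * complex.Re (ip x y).
Proof.
rewrite /q (ipDr ipP) !ipDl !ReD (Re_ipC y x).
by set a := complex.Re _; set b := complex.Re _; set c := complex.Re _; ring.
Qed.

Lemma sqipZ c x : q (c *: x) = csq c * q x.
Proof.
have -> : q (c *: x) = complex.Re (c * conjc c * ip x x).
  by rewrite /q (ipZr ipP) ipZl mulrA.
by rewrite csqE ipxx -rmorphM.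
Qed.

Lemma sqipZr (a : R) x : q (a%:C%C *: x) = a ^+ 2 * q x.
Proof. by rewrite sqipZ /csq /= expr0n addr0. Qed.

Lemma sqipN x : q (- x) = q x.
Proof. by rewrite -scaleN1r sqipZ /csq /=; rewrite oppr0 sqrrN expr1n expr0n addr0 mul1r. Qed.

Lemma sqipB x y : q (x - y) = q x + q y - 2 * complex.Re (ip x y).
Proof.
rewrite sqipD sqipN -[- y]scaleN1r (ipZr ipP) mulN1r.
by case: (ip x y) => a b /=; ring.
Qed.

Lemma sqipBC x y : q (x - y) = q (y - x).
Proof. by rewrite -sqipN opprB. Qed.

(* Half of the parallelogram law, used in place of the triangle inequality. *)
Lemma sqipD_le x y : q (x + y) <= 2 * q x + 2 * q y.
Proof. have := sqip_ge0 (x - y); rewrite sqipB sqipD; lra. Qed.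

Lemma sqip_trans z x y : q (x - y) <= 2 * q (x - z) + 2 * q (z - y).
Proof. by rewrite -(subrKA z x); exact: sqipD_le. Qed.

(** Expand q(x - <a,x> a) >= 0. *)
Lemma sqip_proj a x : q a = 1 -> csq (ip a x) <= q x.
Proof.
move=> qa; have := sqip_ge0 (x - ip a x *: a).
rewrite sqipB sqipZ qa (ipZr ipP) mulr1.
rewrite [ip x a](ip_conj ipP) csqE /=; lra.
Qed.

(** If <a,x> were nonzero, adding multiples of [x] to [a] would change [q] linearly and make it
    negative. *)
Lemma ip_null a x : q x = 0 -> ip a x = 0.
Proof.
move=> qx; apply: csq_eq0; apply/eqP/negPn/negP => s0.
have {}s0 : 0 < csq (ip a x) by rewrite lt_def s0 csq_ge0.
(* With this [t] the value of [q] is exactly -1. *)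
set t := - (q a + 1) / (2 * csq (ip a x)).
have := sqip_ge0 (a + (t%:C%C * conjc (ip a x)) *: x).
rewrite sqipD sqipZ qx mulr0 (ipZr ipP) -mulrA [_^* * _]mulrC csqE -rmorphM /=.
have -> : 2 * (t * csq (ip a x)) = - (q a + 1) by rewrite /t; field; rewrite gt_eqF.
lra.
Qed.

(** Scaling [a] to a unit vector reduces it to [sqip_proj]; a null [a] is covered by [ip_null]. *)
Lemma cauchy_schwarz a x : csq (ip a x) <= q a * q x.
Proof.
have [qa|qa] := eqVneq (q a) 0.
  rewrite (ip_eq0C (ip_null _ qa)) /csq /= expr0n addr0 mulr_ge0 ?sqip_ge0//.
have qa0 : 0 < q a by rewrite lt_def qa sqip_ge0.
set s := (Num.sqrt (q a))^-1.
have ss : s ^+ 2 = (q a)^-1 by rewrite exprVn sqr_sqrtr// ltW.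
have /(sqip_proj x) : q (s%:C%C *: a) = 1 by rewrite sqipZr ss mulVf.
rewrite ipZl conjc_real /csq.
have -> : complex.Re (s%:C%C * ip a x) = s * complex.Re (ip a x) by case: (ip a x) => ? ? /=; ring.
have -> : complex.Im (s%:C%C * ip a x) = s * complex.Im (ip a x) by case: (ip a x) => ? ? /=; ring.
by rewrite !exprMn -mulrDr ss mulrC ler_pdivrMr// [q x * _]mulrC.
Qed.

Definition qlim (u : nat -> V) y := forall e : R, 0 < e ->
  exists N, forall n, (N <= n)%N -> q (u n - y) < e.

Definition orth (A : set V) x := forall a, A a -> ip a x = 0.

Lemma orth_lin A c d x y : orth A x -> orth A y -> orth A (c *: x + d *: y).
Proof. by move=> Ax Ay a Aa; rewrite (ipDr ipP) !(ipZr ipP) Ax// Ay// !mulr0 addr0. Qed.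

Lemma orthZ A c x : orth A x -> orth A (c *: x).
Proof. by move=> Ax a Aa; rewrite (ipZr ipP) Ax// mulr0. Qed.

(** By Cauchy-Schwarz, <a,x> depends continuously on [x] for the seminorm. *)
Lemma orth_closed A y :
  (forall e, 0 < e -> exists2 x, orth A x & q (x - y) < e) -> orth A y.
Proof.
move=> h a Aa; apply: csq_eq0; apply/eqP; rewrite eq_le csq_ge0 andbT.
apply/ler_addgt0Pr => e e0; rewrite add0r.
(* The added 1 keeps the divisor positive when [a] is null. *)
have qa : 0 < q a + 1 by have := sqip_ge0 a; lra.
have [x Ax xy] := h (e / (q a + 1)) (divr_gt0 e0 qa).
have := cauchy_schwarz a (x - y).
rewrite ipBr Ax// sub0r -[csq (- _)]/(csq _) => cs.
have -> : csq (ip a y) = csq (- ip a y) by rewrite /csq; case: (ip a y) => b c /=; rewrite !sqrrN.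
apply: (le_trans cs); rewrite ltr_pdivlMr// in xy.
have := sqip_ge0 (x - y); nra.
Qed.

(** * Finite orthonormal families and Bessel's inequality *)

Section Orthonormal.
Variable psi : nat -> V.

Definition orthonormal_upto n :=
  forall i j, (i < n)%N -> (j < n)%N -> ip (psi i) (psi j) = (i == j)%:R.

Lemma ip_psum m n k (c : nat -> R[i]) : orthonormal_upto n -> (k < n)%N ->
  ip (psi k) (\sum_(m <= i < n) c i *: psi i) = if (m <= k)%N then c k else 0.
Proof.
move=> on kn; rewrite ip_sumr.
under eq_big_nat => i /andP[mi ni] do rewrite (ipZr ipP) on//.
case: leqP => mk.
  rewrite (bigD1_seq k) ?mem_index_iota ?mk ?iota_uniq//= eqxx mulr1.
  by rewrite big1 ?addr0// => i; rewrite eq_sym => /negPf->; rewrite mulr0.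
by rewrite big_nat big1// => i /andP[mi _]; rewrite ltn_eqF ?mulr0// (leq_trans mk).
Qed.

Lemma sqip_psum m n (c : nat -> R[i]) : orthonormal_upto n ->
  q (\sum_(m <= i < n) c i *: psi i) = \sum_(m <= i < n) csq (c i).
Proof.
move=> on; have [nm|mn] := leqP n m; first by rewrite !big_geq// sqip0.
have E : ip (\sum_(m <= i < n) c i *: psi i) (\sum_(m <= i < n) c i *: psi i)
   = \sum_(m <= i < n) (csq (c i))%:C%C.
  rewrite {2}big_nat ip_sumr [RHS]big_nat; apply: eq_bigr => i /andP[mi ni].
  by rewrite (ipZr ipP) (ip_conj ipP) ip_psum// mi csqE.
by rewrite /q E -rmorph_sum.
Qed.

Lemma sqip_residual n x : orthonormal_upto n ->
  q (x - \sum_(0 <= i < n) ip (psi i) x *: psi i)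
  = q x - \sum_(0 <= i < n) csq (ip (psi i) x).
Proof.
move=> on; rewrite sqipB sqip_psum// ip_sumr.
have -> : \sum_(0 <= i < n) ip x (ip (psi i) x *: psi i) =
          (\sum_(0 <= i < n) csq (ip (psi i) x))%:C%C.
  rewrite rmorph_sum; apply: eq_bigr => i _.
  by rewrite (ipZr ipP) [ip x _](ip_conj ipP) csqE.
rewrite /=; ring.
Qed.

Lemma residual_orth n x k : orthonormal_upto n -> (k < n)%N ->
  ip (psi k) (x - \sum_(0 <= i < n) ip (psi i) x *: psi i) = 0.
Proof. by move=> on kn; rewrite ipBr ip_psum//= subrr. Qed.

Lemma bessel n x : orthonormal_upto n -> \sum_(0 <= i < n) csq (ip (psi i) x) <= q x.
Proof.
move=> on; have := sqip_ge0 (x - \sum_(0 <= i < n) ip (psi i) x *: psi i).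
by rewrite sqip_residual// subr_ge0.
Qed.

(** The partial sums of squared coefficients increase and are bounded by [q x]; past one within [e]
    of their supremum, every block is below [e]. *)
Lemma bessel_tail x : (forall n, orthonormal_upto n) -> forall e : R, 0 < e ->
  exists N, forall m n, (N <= m)%N -> (m <= n)%N ->
    \sum_(m <= i < n) csq (ip (psi i) x) < e.
Proof.
move=> on e e0; set S := [set \sum_(0 <= i < n) csq (ip (psi i) x) | n in setT]%classic.
have supS : has_sup S.
  split; first by exists 0; exists 0%N => //; rewrite big_geq.
  by exists (q x) => _ [n _ <-]; apply: bessel.
have [_ [N _ <-] sN] := sup_adherent e0 supS.
exists N => m n Nm mn.
have : \sum_(0 <= i < n) csq (ip (psi i) x) <= sup S.
  by apply: sup_upper_bound => //; exists n.
rewrite (big_cat_nat (n := m))//= (big_cat_nat (n := N) (p := m))//=.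
have : 0 <= \sum_(N <= i < m) csq (ip (psi i) x) by apply: sumr_ge0 => i _; exact: csq_ge0.
lra.
Qed.

End Orthonormal.


(** * Compact self-adjoint operators modulo null vectors *)

Section CompactSelfAdjoint.
Variable T : V -> V.
Hypothesis T_lin : forall c x y, T (c *: x + y) = c *: T x + T y.
Hypothesis T_sa : forall x y, ip x (T y) = ip (T x) y.
Hypothesis T_compact : forall u, (exists B, forall n, q (u n) <= B) ->
  exists k : nat -> nat, increasing_seq k /\ exists y, qlim (fun n => T (u (k n))) y.

Lemma T0 : T 0 = 0.
Proof. by apply: (addIr (T 0)); rewrite -[X in X + _]scale1r -T_lin scale1r !add0r. Qed.

Lemma TZ c x : T (c *: x) = c *: T x.
Proof. by rewrite -[c *: x]addr0 T_lin T0 addr0. Qed.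

Lemma TB x y : T (x - y) = T x - T y.
Proof. by rewrite addrC -scaleN1r T_lin scaleN1r addrC. Qed.

(** <Tx,Tx> = <TTx,x> vanishes, so [T] acts on the quotient by null vectors. *)
Lemma T_null x : q x = 0 -> q (T x) = 0.
Proof. by move=> qx; rewrite /q T_sa (ip_null _ qx). Qed.

Lemma increasing_geid (k : nat -> nat) : increasing_seq k -> forall n, (n <= k n)%N.
Proof.
move=> ik; elim=> // n; move/leq_ltn_trans; apply.
by rewrite ltnNge -leEnat ik -ltnNge.
Qed.

(** Otherwise some unit vectors have images of unbounded seminorm, against the convergent
    subsequence given by compactness. *)
Lemma T_bounded : exists B, forall x, q x = 1 -> q (T x) <= B.
Proof.
apply: contrapT => /forallNP unb.
have /choice[u uP] : forall n, exists x, q x = 1 /\ n%:R < q (T x).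
  move=> n; have /existsNP[x /not_implyP[x1 /negP]] := unb n%:R.
  by rewrite -ltNge => xn; exists x.
have [|k [ik [y lim]]] := T_compact (u := u).
  by exists 1 => n; have [-> _] := uP n.
have [N lN] := lim 1 ltr01.
(* The image at [k n] is within 1 of [y], so its [q] is below [2 + 2 * q y]; yet it exceeds
   [k n >= n], which is larger. *)
pose n := maxn N (Num.trunc (2 + 2 * q y)).+1.
have := lN n (leq_maxl _ _).
have [_ big] := uP (k n).
have := sqipD_le (T (u (k n)) - y) y; rewrite subrK.
have := truncnS_gt (2 + 2 * q y).
have : ((Num.trunc (2 + 2 * q y)).+1%:R : R) <= (k n)%:R.
  by rewrite ler_nat (leq_trans (leq_maxr N _))// increasing_geid.
lra.
Qed.

(** The equation holds up to a null vector; multiplying by the idempotent later makes it exact. *)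
Definition eigenvector e := q e = 1 /\ exists mu : R, q (T e - mu%:C%C *: e) = 0.

Lemma normalize_eigenvector (A : set V) x (mu : R) : orth A x -> q x != 0 ->
  q (T x - mu%:C%C *: x) = 0 -> exists2 e, orth A e & eigenvector e.
Proof.
move=> Ax qx Tx; pose s := (Num.sqrt (q x))^-1.
have ss : s ^+ 2 = (q x)^-1 by rewrite exprVn sqr_sqrtr// sqip_ge0.
exists (s%:C%C *: x); first exact: orthZ.
split; first by rewrite sqipZr ss mulVf.
by exists mu; rewrite TZ scalerA mulrC -scalerA -scalerBr sqipZr Tx mulr0.
Qed.

(** <e,Tx> = <Te,x>, the form does not see the null error, and [mu] is its own conjugate. *)
Lemma ip_eigen e (mu : R) x : q (T e - mu%:C%C *: e) = 0 ->
  ip e (T x) = mu%:C%C * ip e x.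
Proof.
move=> /ip_null => /(_ x) /ip_eq0C; rewrite ipBl ipZl conjc_real => /eqP.
by rewrite subr_eq0 T_sa => /eqP.
Qed.

(** * Eigenvectors in the orthogonal complement of given eigenvectors *)

Section Invariant.
Variable A : set V.
Hypothesis A_eigen : forall a, A a -> eigenvector a.

Lemma orth_T x : orth A x -> orth A (T x).
Proof.
by move=> Ax a Aa; have [_ [mu /ip_eigen->]] := A_eigen Aa; rewrite Ax// mulr0.
Qed.

(** The supremum is the squared operator norm of [T] on the complement of [A]. *)
Definition opvalues : set R := [set q (T x) | x in [set x | orth A x /\ q x = 1]]%classic.

Lemma opvalues_bound x : has_sup opvalues -> orth A x ->
  q (T x) <= sup opvalues * q x.
Proof.
move=> hs Ax; have [qx|qx] := eqVneq (q x) 0; first by rewrite T_null// qx mulr0.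
have qx0 : 0 < q x by rewrite lt_def qx sqip_ge0.
pose s := (Num.sqrt (q x))^-1.
have ss : s ^+ 2 = (q x)^-1 by rewrite exprVn sqr_sqrtr// sqip_ge0.
have : q (T (s%:C%C *: x)) <= sup opvalues.
  apply: sup_upper_bound => //; exists (s%:C%C *: x) => //=; split; first exact: orthZ.
  by rewrite sqipZr ss mulVf.
by rewrite TZ sqipZr ss mulrC ler_pdivrMr.
Qed.

(** Self-adjointness turns the cross term <TTx,x> into [q (T x)]. *)
Lemma sqipTT m x : q x = 1 ->
  q (T (T x) - m%:C%C *: x) = q (T (T x)) + m ^+ 2 - 2 * m * q (T x).
Proof.
move=> x1; rewrite sqipB sqipZr x1 mulr1 (ipZr ipP) -T_sa ipxx -rmorphM /= mulrA.
by rewrite [T x]lock.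
Qed.

(** By [sqipTT] and q(TTx) <= m q(Tx), q(TTx - m x) <= m (m - q(Tx)), which tends to 0 along a
    maximizing sequence; compactness supplies the limit [y] of the images. *)
Lemma approx_eigen : has_sup opvalues -> 0 < sup opvalues ->
  exists y, forall e, 0 < e -> exists x,
    [/\ orth A x, q x = 1, q (T (T x) - (sup opvalues)%:C%C *: x) < e & q (T x - y) < e].
Proof.
move=> hs; set m := sup opvalues => m0.
have /choice[u uP] : forall n, exists x, [/\ orth A x, q x = 1 & m - n.+1%:R^-1 < q (T x)].
  move=> n; have n0 : 0 < n.+1%:R^-1 :> R by rewrite invr_gt0 ltr0Sn.
  by have [_ [x [Ax x1] <-] h] := sup_adherent n0 hs; exists x.
have [|k [ik [y lim]]] := T_compact (u := u).
  by exists 1 => n; have [_ -> _] := uP n.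
exists y => e e0; have [N lN] := lim e e0.
(* Ensures m / (k n + 1) < e. *)
pose n := maxn N (Num.trunc (m / e)).
exists (u (k n)); have [Ax x1 xm] := uP (k n); split => //; last exact: lN (leq_maxl _ _).
have : m / e < (k n).+1%:R.
  apply: (lt_le_trans (truncnS_gt _)); rewrite ler_nat ltnS.
  by apply: leq_trans (increasing_geid ik n); exact: leq_maxr.
rewrite ltr_pdivrMr// -ltr_pdivrMl ?ltr0Sn// => me.
rewrite sqipTT//.
have := opvalues_bound hs (orth_T Ax); rewrite -/m.
move: xm me; set d := _^-1; set t := q (T (u (k n))); nra.
Qed.

(* If [m] is the supremum of |Tx|^2 over unit vectors of the subspace, a maximizing sequence gives
   T^2 x = m x, so either (T + sqrt m) x or x itself is an eigenvector. *)
Lemma exists_eigenvector w : orth A w -> q w != 0 ->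
  exists2 e, orth A e & eigenvector e.
Proof.
move=> Aw qw; have qw0 : 0 < q w by rewrite lt_def qw sqip_ge0.
pose s := (Num.sqrt (q w))^-1.
have w1 : q (s%:C%C *: w) = 1.
  by rewrite sqipZr exprVn sqr_sqrtr ?sqip_ge0// mulVf.
have hs : has_sup opvalues.
  split; first by exists (q (T (s%:C%C *: w))), (s%:C%C *: w) => //; split => //; exact: orthZ.
  by have [B hB] := T_bounded; exists B => _ [x [_ x1] <-]; exact: hB.
have m0 : 0 <= sup opvalues.
  apply: le_trans (sqip_ge0 (T (s%:C%C *: w))) _.
  by apply: sup_upper_bound => //; exists (s%:C%C *: w) => //; split => //; exact: orthZ.
(* Here [T] is null on the complement, and [w] is an eigenvector for 0. *)
have [m00|mn0] := eqVneq (sup opvalues) 0.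
  apply: (normalize_eigenvector (mu := 0) Aw qw).
  rewrite scale0r subr0; apply/eqP; rewrite eq_le sqip_ge0 andbT.
  by have := opvalues_bound hs Aw; rewrite m00 mul0r.
have {}m0 : 0 < sup opvalues by rewrite lt_def mn0.
have [y yP] := approx_eigen hs m0.
have bnd := opvalues_bound hs.
move: hs m0 mn0 yP bnd; set m := sup opvalues => hs m0 mn0 yP bnd.
have Ay : orth A y.
  apply: orth_closed => e e0; have [x [Ax _ _ xy]] := yP e e0.
  by exists (T x) => //; exact: orth_T.
(* From Tz near y and TTz near m z, the unit vectors z approach Ty / m. *)
pose x := (m^-1)%:C%C *: T y.
have Ax : orth A x by apply: orthZ; exact: orth_T.
have mx : m%:C%C *: x = T y by rewrite /x scalerA -rmorphM /= mulfV// scale1r.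
have near_x e : 0 < e -> exists z, [/\ orth A z, q z = 1, q (z - x) < e & q (T z - y) < e].
  (* m^2 q(z - x) <= 2 q(m z - TTz) + 2 q(T(Tz - y)) < (2 + 2m) d. *)
  move=> e0; pose d := Num.min e (e * m ^+ 2 / (2 + 2 * m)).
  have d0 : 0 < d by rewrite lt_min e0 divr_gt0// ?mulr_gt0 ?exprn_gt0//; lra.
  have [z [Az z1 zm zy]] := yP d d0; exists z; split => //; last first.
    by apply: (lt_le_trans zy); rewrite ge_min lexx.
  have := sqip_trans (T (T z)) (m%:C%C *: z) (m%:C%C *: x).
  rewrite -scalerBr sqipZr mx [q (_ - T (T z))]sqipBC -TB.
  have AT : orth A (T z - y).
    by have := orth_lin 1 (-1) (orth_T Az) Ay; rewrite scale1r scaleN1r.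
  have := bnd _ AT.
  have dm : d * (2 + 2 * m) <= e * m ^+ 2.
    by rewrite -ler_pdivlMr ?ge_min ?lexx ?orbT//; lra.
  have m20 : 0 < m ^+ 2 by rewrite exprn_gt0.
  move=> h1 h2; rewrite -(ltr_pM2l m20); apply: (le_lt_trans h2).
  apply: lt_le_trans (_ : d * (2 + 2 * m) <= _); last by rewrite [m ^+ 2 * e]mulrC.
  have := ltr_pM2l m0 (q (T z - y)) d; rewrite zy; lra.
have Txy : q (T x - y) = 0.
  apply/eqP; rewrite eq_le sqip_ge0 andbT; apply/ler_addgt0Pr => e e0; rewrite add0r.
  have d0 : 0 < e / (2 + 2 * m) by rewrite divr_gt0//; lra.
  have [z [Az z1 zx zy]] := near_x _ d0.
  have AT : orth A (z - x) by have := orth_lin 1 (-1) Az Ax; rewrite scale1r scaleN1r.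
  have := bnd _ AT; rewrite TB sqipBC.
  have := sqip_trans (T z) (T x) y.
  move: zx zy; set d := e / _ => zx zy.
  have de : d * (2 + 2 * m) = e by rewrite /d divfK// gt_eqF//; lra.
  have := ltr_pM2l m0 (q (z - x)) d; rewrite zx; lra.
have TTx : q (T (T x) - m%:C%C *: x) = 0 by rewrite mx -TB T_null.
(* Unit vectors come arbitrarily close to [x]. *)
have qx : q x != 0.
  have [|z [_ z1 zx _]] := near_x (1/2); first lra.
  apply/eqP => qx; have := sqipD_le (z - x) x; rewrite subrK qx z1; lra.
pose mu := Num.sqrt m.
have mumu : mu%:C%C * mu%:C%C = m%:C%C :> R[i].
  by rewrite -rmorphM /= -expr2 sqr_sqrtr// ltW.
(* Up to null vectors (T - mu)(T + mu) x = 0: [z] has eigenvalue [mu], or is null and [x] has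
   eigenvalue [- mu]. *)
pose z := mu%:C%C *: x + T x.
have Az : orth A z by have := orth_lin mu%:C%C 1 Ax (orth_T Ax); rewrite scale1r.
have [qz|qz] := eqVneq (q z) 0.
  apply: (normalize_eigenvector (mu := - mu) Ax qx).
  by rewrite rmorphN scaleNr opprK addrC.
apply: (normalize_eigenvector (mu := mu) Az qz).
by rewrite /z T_lin scalerDr scalerA mumu [_ + T (T x)]addrC [m%:C%C *: x + _]addrC addrKA.
Qed.

End Invariant.

(** * Greedy construction of a complete orthonormal sequence of eigenvectors *)

Section Expansion.
Variable D : nat -> V.
Hypothesis D_dense : forall x e, 0 < e -> exists n, q (x - D n) < e.
Hypothesis V_infdim : forall n (v : 'I_n -> V), exists x, forall c : 'I_n -> R[i],
  q (x - \sum_(k < n) c k *: v k) != 0.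
Hypothesis V_complete : forall u : nat -> V,
  (forall e, 0 < e -> exists N, forall m n, (N <= m)%N -> (m <= n)%N -> q (u m - u n) < e) ->
  exists y, qlim u y.

Definition previous (psi : nat -> V) n : set V := [set psi k | k in [set k | (k < n)%N]]%classic.

(* [logn 2 n.+1] takes every value infinitely often, so each [D j] is treated at infinitely many
   stages. *)
Definition target n := D (logn 2 n.+1).

Lemma target_infinitely_often j N : exists2 n, (N <= n)%N & target n = D j.
Proof.
(* The odd factor fixes the 2-adic valuation at [j] and pushes [n] past [N]; the predecessor offsets
   the shift in [target]. *)
pose n := (2 ^ j * (N.*2.+1))%N; have n0 : (0 < n)%N by rewrite muln_gt0 expn_gt0.
exists n.-1.
  rewrite -ltnS prednK// -[N.+1]mul1n leq_mul ?expn_gt0// ltnS -addnn.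
  exact: leq_addr.
rewrite /target prednK// lognM ?expn_gt0// pfactorK// [logn 2 _.+1]lognE /=.
by rewrite dvdn2 /= odd_double addn0.
Qed.

(** The factor 2 allows a choice near the supremum, without a maximizer. *)
Definition greedy (psi : nat -> V) n e :=
  [/\ orth (previous psi n) e, eigenvector e &
    forall e', orth (previous psi n) e' -> eigenvector e' ->
      csq (ip e' (target n)) <= 2 * csq (ip e (target n))].

Lemma greedy_orthonormal psi n :
  (forall k, (k < n)%N -> greedy psi k (psi k)) -> orthonormal_upto psi n.
Proof.
move=> g; have prev : forall i j, (i < j)%N -> (j < n)%N -> ip (psi i) (psi j) = 0.
  by move=> i j ij jn; have [po _ _] := g _ jn; apply: po; exists i.
move=> i j i_n jn; case: ltngtP => [ij|ji|->]; first exact: prev.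
  exact/ip_eq0C/prev.
by have [_ [q1 _] _] := g _ jn; rewrite ipxx q1.
Qed.

(** A vector outside the span of the first [n] terms has a non-null residual, so competitors exist;
    one above half the supremum is taken. *)
Lemma greedy_step psi n :
  (forall k, (k < n)%N -> greedy psi k (psi k)) -> exists e, greedy psi n e.
Proof.
move=> g; have on := greedy_orthonormal g.
have eig a : previous psi n a -> eigenvector a by move=> [k /= kn <-]; have [] := g _ kn.
have [x xP] := V_infdim (fun k : 'I_n => psi k).
have [||e1 oe1 ee1] := exists_eigenvector eig (w := x - \sum_(0 <= i < n) ip (psi i) x *: psi i).
- by move=> a [k /= kn <-]; exact: residual_orth.
- by rewrite big_mkord; exact: (xP (fun i => ip (psi i) x)).
pose S := [set csq (ip e (target n)) | e in [set e | orth (previous psi n) e /\ eigenvector e]]%classic.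
have hs : has_sup S.
  split; first by exists (csq (ip e1 (target n))), e1.
  by exists (q (target n)) => _ [e [_ [q1 _]] <-]; exact: sqip_proj.
have ub e : orth (previous psi n) e -> eigenvector e -> csq (ip e (target n)) <= sup S.
  by move=> oe ee; apply: sup_upper_bound => //; exists e.
(* Half the supremum lies below it only if it is positive; otherwise any competitor will do. *)
have [s0|s0] := leP (sup S) 0.
  exists e1; split=> // e oe ee; apply: le_trans (le_trans (ub e oe ee) s0) _.
  by rewrite mulr_ge0// csq_ge0.
have [|_ [e [oe ee] <-] h] := sup_adherent (_ : 0 < sup S / 2) hs; first by rewrite divr_gt0.
exists e; split=> // e' oe' ee'; have := ub e' oe' ee'; lra.
Qed.

Lemma greedy_ext psi psi' n e : (forall k, (k < n)%N -> psi k = psi' k) ->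
  greedy psi n e -> greedy psi' n e.
Proof.
move=> eqp; rewrite /greedy; suff -> : previous psi n = previous psi' n by [].
by apply/seteqP; split=> _ [k /= kn <-]; exists k => //; rewrite eqp.
Qed.

Lemma greedy_complete psi x : (forall n, greedy psi n (psi n)) ->
  orth (range psi) x -> q x = 0.
Proof.
move=> g ox; apply/eqP/negPn/negP => qx.
have [|e oe ee] := exists_eigenvector _ ox qx.
  by move=> _ [k _ <-]; have [] := g k.
have [q1 _] := ee.
have [j ej] := D_dense e (ltr01 : 0 < 1 :> R).
(* If <e, D j> were 0, Cauchy-Schwarz for [e] and [e - D j] would give 1 <= q(e - D j) < 1. *)
have c0 : 0 < csq (ip e (D j)).
  rewrite lt_def csq_ge0 andbT; apply/eqP => /csq_eq0 h.
  have := cauchy_schwarz e (e - D j).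
  rewrite ipBr h subr0 ipxx q1 mul1r /csq /= expr1n expr0n addr0; lra.
have on n : orthonormal_upto psi n by apply: greedy_orthonormal => k _.
(* Past [N] each coefficient of [D j] is below half of [csq (ip e (D j))], whereas the greedy choice
   at a stage treating [D j] gives at least half. *)
have [N hN] := bessel_tail (D j) on (divr_gt0 c0 (ltr0Sn _ 1)).
have [n Nn tn] := target_infinitely_often j N.
have := hN _ _ Nn (leqnSn n); rewrite big_nat1.
have [_ _ /(_ e)] := g n; rewrite tn => h.
have : csq (ip e (D j)) <= 2 * csq (ip (psi n) (D j)).
  by apply: h => // _ [k _ <-]; apply: oe; exists k.
lra.
Qed.

(** By Bessel the Fourier sums of [x] are Cauchy; [x] minus their limit is orthogonal to every
    [psi k], hence null. *)
Lemma compact_sa_eigenbasis : exists (psi : nat -> V) (mu : nat -> R),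
  [/\ forall n m, ip (psi n) (psi m) = (n == m)%:R,
      forall n, q (T (psi n) - (mu n)%:C%C *: psi n) = 0 &
      forall x, qlim (fun n => \sum_(0 <= i < n) ip (psi i) x *: psi i) x].
Proof.
have [psi g] := prefix_choice 0 greedy_step greedy_ext.
have on n : orthonormal_upto psi n by apply: greedy_orthonormal => k _.
have /choice[mu muP] : forall n, exists mu : R, q (T (psi n) - mu%:C%C *: psi n) = 0.
  by move=> n; have [_ [_ ]] := g n.
exists psi, mu; split=> // [n m|x].
  by apply: (on (maxn n m).+1); rewrite ltnS ?leq_maxl ?leq_maxr.
pose u n := \sum_(0 <= i < n) ip (psi i) x *: psi i.
have [|y uy] := V_complete (u := u).
  move=> e e0; have [N hN] := bessel_tail x on e0; exists N => m n Nm mn.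
  rewrite sqipBC /u (big_cat_nat (n := m) (p := n))//= [X in q X]addrC addKr.
  by rewrite sqip_psum//; exact: hN.
have xy : q (x - y) = 0.
  apply: (greedy_complete g) => _ [k _ <-].
  suff : orth [set psi k]%classic (x - y) by apply.
  apply: orth_closed => e e0; have [N hN] := uy e e0.
  (* The index exceeds [k], so this residual is orthogonal to [psi k], and is at least [N], so it is
     close to [x - y]. *)
  exists (x - u (maxn N k.+1)).
    by move=> _ ->; apply: residual_orth => //; rewrite leq_max ltnSn orbT.
  by rewrite opprB [X in q X]addrC subrKA sqipBC hN// leq_maxl.
move=> e e0; have [N hN] := uy (e / 2) (divr_gt0 e0 (ltr0Sn _ 1)).
exists N => n Nn; have := sqip_trans y (u n) x; rewrite [q (y - x)]sqipBC xy.
by have := hN n Nn; rewrite /u; lra.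
Qed.

End Expansion.
End CompactSelfAdjoint.
End SemiInnerProduct.

(** * Idempotent components of a bicomplex Hilbert space *)

Section Components.
Variable R : realType.
Implicit Types (u v w : bicomplex R) (c : R[i]).

Lemma sqri_c : 'i%C * 'i%C = -1 :> R[i]. Proof. by rewrite -expr2 sqr_i. Qed.

Lemma P1D u v : P1 (u + v) = P1 u + P1 v.
Proof. by rewrite /P1 /=; ring. Qed.
Lemma P2D u v : P2 (u + v) = P2 u + P2 v.
Proof. by rewrite /P2 /=; ring. Qed.

Lemma P1M u v : P1 (u * v) = P1 u * P1 v.
Proof.
transitivity (bc1 u * bc1 v - (bc1 u * bc2 v + bc2 u * bc1 v) * 'i%C + bc2 u * bc2 v * -1).
  by rewrite /P1 /=; ring.
by rewrite -sqri_c /P1; ring.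
Qed.
Lemma P2M u v : P2 (u * v) = P2 u * P2 v.
Proof.
transitivity (bc1 u * bc1 v + (bc1 u * bc2 v + bc2 u * bc1 v) * 'i%C + bc2 u * bc2 v * -1).
  by rewrite /P2 /=; ring.
by rewrite -sqri_c /P2; ring.
Qed.

Lemma P1_complex c : P1 (bc_of_complex c) = c.
Proof. by rewrite /P1 /= mul0r subr0. Qed.
Lemma P2_complex c : P2 (bc_of_complex c) = c.
Proof. by rewrite /P2 /= mul0r addr0. Qed.

Lemma P1_dagger w : P1 (dagger3 w) = conjc (P1 w).
Proof. by case: w => -[a b] [c d]; congr Complex => /=; ring. Qed.
Lemma P2_dagger w : P2 (dagger3 w) = conjc (P2 w).
Proof. by case: w => -[a b] [c d]; congr Complex => /=; ring. Qed.

Lemma half_complex : (2^-1)%:C%C = 2^-1 :> R[i].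
Proof. by rewrite fmorphV rmorph_nat. Qed.

Lemma P1_be1 : P1 be1 = 1 :> R[i].
Proof.
have i2 : P1 bi2 = - 'i%C :> R[i] by rewrite /P1 /= mul1r sub0r.
rewrite /be1 P1M P1D P1M i2 (P1_complex _%:C%C) (P1_complex 1) (P1_complex 'i%C) mulrN sqri_c.
by rewrite opprK half_complex mulVf// pnatr_eq0.
Qed.
Lemma P2_be1 : P2 be1 = 0 :> R[i].
Proof.
have i2 : P2 bi2 = 'i%C :> R[i] by rewrite /P2 /= mul1r add0r.
by rewrite /be1 P2M P2D P2M i2 (P2_complex 1) (P2_complex 'i%C) sqri_c subrr mulr0.
Qed.
Lemma be2E : be2 = 1 - be1 :> bicomplex R.
Proof.
rewrite /be1 /be2 /bc_of_real half_complex.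
by congr Bicomplex => /=; field.
Qed.
Lemma P1_be2 : P1 be2 = 0 :> R[i].
Proof. by apply: (addIr (P1 be1)); rewrite -P1D be2E subrK P1_be1 add0r (P1_complex 1). Qed.
Lemma P2_be2 : P2 be2 = 1 :> R[i].
Proof. by apply: (addIr (P2 be1)); rewrite -P2D be2E subrK P2_be1 addr0 (P2_complex 1). Qed.

Lemma bicomplex_ext u v : P1 u = P1 v -> P2 u = P2 v -> u = v.
Proof.
by move=> u1 u2; rewrite (idempotent_decomposition u) u1 u2 -idempotent_decomposition.
Qed.

(** Common interface of the pairs (P1, e1) and (P2, e2), so that the spectral argument is carried
    out once. *)
Record idempotent_component (P : bicomplex R -> R[i]) (e : bicomplex R) : Prop := {
  componentD : forall u v, P (u + v) = P u + P v;
  componentM : forall u v, P (u * v) = P u * P v;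
  component_complex : forall c, P (bc_of_complex c) = c;
  component_dagger : forall w, P (dagger3 w) = conjc (P w);
  component_Dplus : forall w, Dplus w -> 0 <= complex.Re (P w);
  component_mul : forall w, w * e = bc_of_complex (P w) * e;
  component_idem : P e = 1;
  idem_dagger : dagger3 e = e
}.

Lemma component1 : idempotent_component (@P1 R) be1.
Proof.
split.
- exact: P1D.
- exact: P1M.
- exact: P1_complex.
- exact: P1_dagger.
- move=> w [x [y [x0 _ ->]]].
  by rewrite P1D (P1M (_ x)) (P1M (_ y)) !(P1_complex _%:C%C) P1_be1 P1_be2 mulr1 mulr0 addr0.
- by move=> w; apply: bicomplex_ext;
  [rewrite P1M [RHS]P1M P1_complex
  |rewrite P2M [RHS]P2M P2_be1 !mulr0].
- exact: P1_be1.
- by apply: bicomplex_ext; rewrite ?P1_dagger ?P2_dagger ?P1_be1 ?P2_be1 ?conjc1 ?conjc0.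
Qed.

Lemma component2 : idempotent_component (@P2 R) be2.
Proof.
split.
- exact: P2D.
- exact: P2M.
- exact: P2_complex.
- exact: P2_dagger.
- move=> w [x [y [_ y0 ->]]].
  by rewrite P2D (P2M (_ x)) (P2M (_ y)) !(P2_complex _%:C%C) P2_be1 P2_be2 mulr1 mulr0 add0r.
- by move=> w; apply: bicomplex_ext;
  [rewrite P1M [RHS]P1M P1_be2 !mulr0
  |rewrite P2M [RHS]P2M P2_complex].
- exact: P2_be2.
- by apply: bicomplex_ext; rewrite ?P1_dagger ?P2_dagger ?P1_be2 ?P2_be2 ?conjc1 ?conjc0.
Qed.

End Components.

(** * Restriction of scalars from bicomplex to complex numbers *)

Definition cmod (R : realType) (M : lmodType (bicomplex R)) : Type := M.

Section RestrictScalars.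
Variables (R : realType) (M : lmodType (bicomplex R)).

HB.instance Definition _ := GRing.Zmodule.copy (cmod M) M.

(** The alias [cmod M] keeps the complex module structure apart from the bicomplex one of [M]. *)
Definition cmod_scale (c : R[i]) (x : cmod M) : cmod M := bc_of_complex c *: (x : M).

Lemma cmod_scaleA a b x : cmod_scale a (cmod_scale b x) = cmod_scale (a * b) x.
Proof. by rewrite /cmod_scale scalerA; congr (_ *: _); congr Bicomplex => /=; ring. Qed.
Lemma cmod_scale1 : left_id 1 cmod_scale.
Proof. by move=> x; exact: (scale1r (x : M)). Qed.
Lemma cmod_scaleDr : right_distributive cmod_scale +%R.
Proof. by move=> c x y; exact: (scalerDr (bc_of_complex c) (x : M) y). Qed.
Lemma cmod_scaleDl x : {morph cmod_scale^~ x : a b / a + b}.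
Proof.
move=> a b; rewrite /cmod_scale; have -> : bc_of_complex (a + b) = bc_of_complex a + bc_of_complex b.
  by congr Bicomplex => /=; ring.
exact: (scalerDl (x : M)).
Qed.

HB.instance Definition _ := GRing.Zmodule_isLmodule.Build R[i] (cmod M)
  cmod_scaleA cmod_scale1 cmod_scaleDr cmod_scaleDl.

End RestrictScalars.

(** * Component forms and the ket norm *)

Section KetNorm.
Variables (R : realType) (M : lmodType (bicomplex R)) (sp : M -> M -> bicomplex R).
Hypothesis spP : is_scalar_product sp.

Lemma sp_scalel w x y : sp (w *: x) y = dagger3 w * sp x y.
Proof.
rewrite (sp_dagger spP) (sp_scale spP) [in RHS](sp_dagger spP).
by apply: bicomplex_ext; rewrite ?P1_dagger ?P2_dagger ?P1M ?P2M rmorphM /= ?P1_dagger ?P2_dagger.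
Qed.

Section Component.
Variables (P : bicomplex R -> R[i]) (e : bicomplex R).
Hypothesis PP : idempotent_component P e.

Definition component_ip (x y : cmod M) : R[i] := P (sp x y).

Lemma component_ipP : is_semi_ip component_ip.
Proof.
split=> [x y z|x y c|x y|x]; rewrite /component_ip.
- by rewrite (sp_add spP) (componentD PP).
- by rewrite (sp_scale spP) (componentM PP) (component_complex PP).
- by rewrite (sp_dagger spP) (component_dagger PP).
- exact: (component_Dplus PP (sp_Dplus spP x)).
Qed.

Lemma sqip_scale w (x : M) : sqip component_ip (w *: x) = csq (P w) * sqip component_ip x.
Proof.
have -> : sqip component_ip (w *: x) = complex.Re (P w * conjc (P w) * component_ip x x).
  rewrite /sqip /component_ip (sp_scale spP) sp_scalel !(componentM PP) (component_dagger PP).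
  by rewrite mulrA.
by rewrite csqE (ipxx component_ipP) -rmorphM.
Qed.

Lemma sqip_idem (x : M) : sqip component_ip (e *: x) = sqip component_ip x.
Proof. by rewrite sqip_scale (component_idem PP) /csq /= expr1n expr0n addr0 mul1r. Qed.

Lemma idem_idem : e * e = e.
Proof. by rewrite (component_mul PP) (component_idem PP) mul1r. Qed.

(** sp(ex,ex) = e sp(x,x) = P(sp(x,x)) e = 0, and [sp] is definite. *)
Lemma sqip_definite (x : M) : sqip component_ip x = 0 -> e *: x = 0.
Proof.
move=> x0; apply/(sp_definite spP).
rewrite (sp_scale spP) sp_scalel (idem_dagger PP) mulrA idem_idem mulrC (component_mul PP).
by have := ipxx component_ipP x; rewrite x0 /component_ip => ->;
  rewrite [bc_of_complex _](_ : _ = 0)// mul0r.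
Qed.

End Component.

Lemma bcnorm_ge0 x : 0 <= bcnorm sp x.
Proof. by rewrite mulr_ge0 ?invr_ge0 ?sqrtr_ge0. Qed.

Lemma sqnorm1_ge0 x : 0 <= sqnorm1 sp x.
Proof. exact: (ip_ge0 (component_ipP (component1 R))). Qed.
Lemma sqnorm2_ge0 x : 0 <= sqnorm2 sp x.
Proof. exact: (ip_ge0 (component_ipP (component2 R))). Qed.

Lemma bcnorm_sq x : 2 * bcnorm sp x ^+ 2 = sqnorm1 sp x + sqnorm2 sp x.
Proof.
rewrite /bcnorm exprMn exprVn !sqr_sqrtr ?addr_ge0 ?sqnorm1_ge0 ?sqnorm2_ge0//.
rewrite mulrA mulfV ?pnatr_eq0// mul1r.
by congr (_ + _); [exact: (sqip_idem (component1 R))|exact: (sqip_idem (component2 R))].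
Qed.

(** The second component of e1 x vanishes, so the seminorm of [x] is a true norm of e1 x. *)
Lemma bcnorm_idem1 x : 2 * bcnorm sp (be1 *: x) ^+ 2 = sqnorm1 sp x.
Proof.
rewrite bcnorm_sq [sqnorm1 sp _](sqip_idem (component1 R)).
rewrite [sqnorm2 sp _](sqip_scale (component2 R)) P2_be1 /csq /= expr0n addr0 mul0r.
exact: addr0.
Qed.
Lemma bcnorm_idem2 x : 2 * bcnorm sp (be2 *: x) ^+ 2 = sqnorm2 sp x.
Proof.
rewrite bcnorm_sq [sqnorm2 sp _](sqip_idem (component2 R)).
rewrite [sqnorm1 sp _](sqip_scale (component1 R)) P1_be2 /csq /= expr0n addr0 mul0r.
exact: add0r.
Qed.

Lemma converges_toP (u : nat -> M) x : converges_to sp u x <->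
  forall eps : R, 0 < eps -> exists N, forall n, (N <= n)%N -> bcnorm sp (u n - x) ^+ 2 < eps.
Proof.
split=> [/cvgrPdist_lt h eps eps0|h].
  have s0 : 0 < Num.sqrt eps by rewrite sqrtr_gt0.
  have [N _ hN] := h _ s0; exists N => n Nn; have := hN n Nn.
  rewrite /= sub0r normrN ger0_norm ?bcnorm_ge0// => lt.
  by rewrite -(sqr_sqrtr (ltW eps0)) ltr_pXn2r// nnegrE ?bcnorm_ge0// ltW.
apply/cvgrPdist_lt => eps eps0; have [N hN] := h _ (exprn_gt0 2 eps0).
exists N => // n Nn /=; rewrite sub0r normrN ger0_norm ?bcnorm_ge0//.
by have := hN n Nn; rewrite ltr_pXn2r// nnegrE ?bcnorm_ge0// ltW.
Qed.

End KetNorm.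

(** * Transfer of completeness, compactness and separability to one component *)

Section ComponentSpectral.
Variables (R : realType) (M : lmodType (bicomplex R)) (sp : M -> M -> bicomplex R).
Hypothesis hM : is_hilbert sp.
Variables (P : bicomplex R -> R[i]) (e : bicomplex R).
Hypothesis PP : idempotent_component P e.
Local Notation ipP := (component_ip sp P).
Local Notation q := (sqip ipP).
Hypothesis q_le : forall x : M, q x <= 2 * bcnorm sp x ^+ 2.
Hypothesis bcnorm_e : forall x : M, 2 * bcnorm sp (e *: x) ^+ 2 = q x.

Let spP : is_scalar_product sp := proj1 hM.

Lemma sqip_idem_sub (x y : M) : q (e *: x - y) = q (x - y).
Proof.
by rewrite -(sqip_idem spP PP) scalerBr scalerA (idem_idem PP) -scalerBr (sqip_idem spP PP).
Qed.

Lemma converges_to_qlim (u : nat -> M) y :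
  converges_to sp (fun n => e *: u n) y -> qlim ipP u y.
Proof.
move=> /converges_toP uy eps eps0; have [N hN] := uy _ (divr_gt0 eps0 (ltr0Sn _ 1)).
exists N => n /hN lt; rewrite -[_ - _]/((u n : M) - y) -sqip_idem_sub.
have := q_le (e *: (u n : M) - y); lra.
Qed.

(** A seminorm-Cauchy [u] need not be Cauchy in [M], but [e *: u] is, and its limit is a seminorm
    limit of [u]. *)
Lemma component_complete (u : nat -> cmod M) :
  (forall eps, 0 < eps -> exists N, forall m n, (N <= m)%N -> (m <= n)%N ->
    q (u m - u n) < eps) -> exists y, qlim ipP u y.
Proof.
move=> cau; have [|y uy] := (proj2 hM) (fun n => e *: (u n : M)).
  move=> eps eps0; have [N hN] := cau _ (exprn_gt0 2 eps0); exists N => m n Nm Nn.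
  have lt : q (u m - u n) < eps ^+ 2.
    have [mn|/ltnW nm] := leqP m n; first exact: hN.
    by rewrite (sqipBC (component_ipP spP PP)); exact: hN.
  rewrite -(@ltr_pXn2r _ 2) ?nnegrE ?bcnorm_ge0 ?(ltW eps0)// -scalerBr.
  have := bcnorm_e ((u m : M) - u n); have := sqr_ge0 (bcnorm sp (e *: ((u m : M) - u n))).
  by move: lt; rewrite -[(u m - u n)%R]/((u m : M) - u n); lra.
by exists y; exact: converges_to_qlim.
Qed.

Lemma component_compact (T : {linear M -> M}) (u : nat -> cmod M) : compact_operator sp T ->
  (exists B, forall n, q (u n) <= B) ->
  exists k : nat -> nat, increasing_seq k /\ exists y, qlim ipP (fun n => T (u (k n))) y.
Proof.
move=> Tc [B uB]; have [|k [ik [y ky]]] := Tc (fun n => e *: (u n : M)).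
  (* For the norm b, 2 b^2 <= B and (b - 1)^2 >= 0 give b <= B + 1. *)
  exists (B + 1) => n; have := uB n; have := bcnorm_e (u n).
  have := sqr_ge0 (bcnorm sp (e *: (u n : M)) - 1); nra.
exists k; split=> //; exists y; apply: converges_to_qlim.
by under eq_fun do rewrite -linearZ.
Qed.

Lemma component_dense :
  separable_for (fun x => Num.sqrt (q x)) [set e *: psi | psi in [set: M]]%classic ->
  exists D : nat -> cmod M, forall x eps, 0 < eps -> exists n, q (x - D n) < eps.
Proof.
move=> [S [/countable_injP[f finj] SV dense]].
exists (fun n => xget 0 [set y | S y /\ f y = n]%classic) => x eps eps0.
have ex : [set e *: psi | psi in [set: M]]%classic (e *: (x : M)) by exists x.
have seps : 0 < Num.sqrt eps by rewrite sqrtr_gt0.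
have [y Sy xy] := dense _ ex _ seps.
exists (f y).
have -> : xget 0 [set z | S z /\ f z = f y]%classic = y.
  case: xgetP => [z _ [Sz fz]|/(_ y)]; last by case.
  by apply: finj => //; rewrite inE.
rewrite -[_ - _]/((x : M) - y) -sqip_idem_sub.
by move: xy; rewrite /= ltr_sqrt.
Qed.

(** Were the difference null, multiplying by [e] would put [e *: x] in the span of the
    [e *: v k]. *)
Lemma component_infdim : infinite_dimensional [set e *: psi | psi in [set: M]]%classic ->
  forall n (v : 'I_n -> cmod M), exists x, forall c : 'I_n -> R[i],
    q (x - \sum_(k < n) c k *: v k) != 0.
Proof.
move=> inf n v; have [k|_ [x _ <-] xP] := inf n (fun k => e *: (v k : M)); first by exists (v k).
exists x => c; apply/eqP => /(sqip_definite spP PP).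
rewrite -[(x - _)%R]/((x : M) - _) scalerBr => /eqP; rewrite subr_eq0 => /eqP xe.
apply: (xP c); rewrite xe scaler_sumr; apply: eq_bigr => k _.
by rewrite -[c k *: v k]/(bc_of_complex (c k) *: (v k : M)) !scalerA mulrC.
Qed.

Lemma component_eigenbasis (T : {linear M -> M}) :
  separable_for (fun x => Num.sqrt (q x)) [set e *: psi | psi in [set: M]]%classic ->
  infinite_dimensional [set e *: psi | psi in [set: M]]%classic ->
  self_adjoint sp T -> compact_operator sp T ->
  exists (psi : nat -> M) (mu : nat -> R),
  [/\ forall n m, P (sp (psi n) (psi m)) = (n == m)%:R,
      forall n, e *: T (psi n) = e *: (bc_of_real (mu n) *: psi n) &
      forall x eps, 0 < eps -> exists N, forall n, (N <= n)%N ->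
        q (\sum_(0 <= i < n) bc_of_complex (P (sp (psi i) x)) *: psi i - x) < eps].
Proof.
move=> /component_dense[D Ddense] /component_infdim inf Tsa Tc.
have [|||psi [mu [on eig lim]]] := @compact_sa_eigenbasis R (cmod M) ipP (component_ipP spP PP)
  T _ _ _ D Ddense inf component_complete.
- by move=> c x y; exact: linearP.
- by move=> x y; rewrite /component_ip Tsa.
- by move=> u; exact: component_compact.
exists psi, mu; split => // n; apply/eqP; rewrite -subr_eq0 -scalerBr; apply/eqP.
exact: (sqip_definite spP PP (eig n)).
Qed.

End ComponentSpectral.

(** * Gluing the two components *)

Section Gluing.
Variables (R : realType) (M : lmodType (bicomplex R)) (sp : M -> M -> bicomplex R).
Hypothesis spP : is_scalar_product sp.

Definition glue (x y : M) : M := be1 *: x + be2 *: y.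
Definition glue_scalar (s t : R) : bicomplex R := bc_of_real s * be1 + bc_of_real t * be2.

Lemma be1_be2 : (be1 : bicomplex R) * be2 = 0.
Proof.
by apply: bicomplex_ext; [rewrite P1M P1_be2|rewrite P2M P2_be1 mul0r];
  rewrite ?mulr0 /P1 /P2 /= mul0r ?subr0 ?addr0.
Qed.

Lemma be1_glue (x y : M) : be1 *: glue x y = be1 *: x.
Proof.
by rewrite scalerDr !scalerA be1_be2 scale0r addr0 (idem_idem (component1 R)).
Qed.

Lemma be2_glue (x y : M) : be2 *: glue x y = be2 *: y.
Proof.
by rewrite scalerDr !scalerA mulrC be1_be2 scale0r add0r (idem_idem (component2 R)).
Qed.

Lemma glueE (z : M) : z = glue z z.
Proof. by rewrite /glue -scalerDl be2E addrC subrK scale1r. Qed.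

Lemma ket_ext (x y : M) : be1 *: x = be1 *: y -> be2 *: x = be2 *: y -> x = y.
Proof. by rewrite {3}(glueE x) {3}(glueE y) /glue => -> ->. Qed.

Lemma P1_glue_scalar s t : P1 (glue_scalar s t) = s%:C%C.
Proof.
rewrite /glue_scalar P1D (P1M (bc_of_real s)) (P1M (bc_of_real t)).
by rewrite !(P1_complex _%:C%C) P1_be1 P1_be2 mulr1 mulr0 addr0.
Qed.

Lemma P2_glue_scalar s t : P2 (glue_scalar s t) = t%:C%C.
Proof.
rewrite /glue_scalar P2D (P2M (bc_of_real s)) (P2M (bc_of_real t)).
by rewrite !(P2_complex _%:C%C) P2_be1 P2_be2 mulr1 mulr0 add0r.
Qed.

Lemma dagger_glue_scalar s t : dagger3 (glue_scalar s t) = glue_scalar s t.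
Proof.
by apply: bicomplex_ext; rewrite ?P1_dagger ?P2_dagger ?P1_glue_scalar ?P2_glue_scalar conjc_real.
Qed.

Lemma P1_sp_idem x y : P1 (sp (be1 *: x) y) = P1 (sp x y).
Proof. by rewrite (sp_scalel spP) (idem_dagger (component1 R)) (P1M be1) P1_be1 mul1r. Qed.

Lemma P2_sp_idem x y : P2 (sp (be2 *: x) y) = P2 (sp x y).
Proof. by rewrite (sp_scalel spP) (idem_dagger (component2 R)) (P2M be2) P2_be2 mul1r. Qed.

Lemma P1_sp_glue x y z : P1 (sp (glue x y) z) = P1 (sp x z).
Proof. by rewrite -P1_sp_idem be1_glue P1_sp_idem. Qed.

Lemma P2_sp_glue x y z : P2 (sp (glue x y) z) = P2 (sp y z).
Proof. by rewrite -P2_sp_idem be2_glue P2_sp_idem. Qed.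

(** The first argument is resolved directly, the second after a swap by conjugate symmetry; [b]
    stands for the Kronecker delta. *)
Lemma sp_glue_eq x y x' y' (b : bool) :
  P1 (sp x x') = b%:R -> P2 (sp y y') = b%:R -> sp (glue x y) (glue x' y') = b%:R.
Proof.
move=> h1 h2; apply: bicomplex_ext.
  rewrite P1_sp_glue (sp_dagger spP) P1_dagger P1_sp_glue -P1_dagger -(sp_dagger spP) h1.
  by case: b {h1 h2}; rewrite /P1 /= mul0r subr0.
rewrite P2_sp_glue (sp_dagger spP) P2_dagger P2_sp_glue -P2_dagger -(sp_dagger spP) h2.
by case: b {h1 h2}; rewrite /P2 /= mul0r addr0.
Qed.

Lemma be1_scale_glue w x y : be1 *: (w *: glue x y) = be1 *: (bc_of_complex (P1 w) *: x).
Proof.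
rewrite [LHS]scalerA mulrC (component_mul (component1 R)) -scalerA be1_glue.
by rewrite !scalerA mulrC.
Qed.

Lemma be2_scale_glue w x y : be2 *: (w *: glue x y) = be2 *: (bc_of_complex (P2 w) *: y).
Proof.
rewrite [LHS]scalerA mulrC (component_mul (component2 R)) -scalerA be2_glue.
by rewrite !scalerA mulrC.
Qed.

(** Each seminorm sees only its idempotent part of the glued series, and twice the squared norm is
    the sum of the two squared seminorms. *)
Lemma glue_converges (a b : nat -> M) (w : nat -> bicomplex R) x :
  (forall eps, 0 < eps -> exists N, forall n, (N <= n)%N ->
    sqnorm1 sp (\sum_(0 <= i < n) bc_of_complex (P1 (w i)) *: a i - x) < eps) ->
  (forall eps, 0 < eps -> exists N, forall n, (N <= n)%N ->
    sqnorm2 sp (\sum_(0 <= i < n) bc_of_complex (P2 (w i)) *: b i - x) < eps) ->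
  converges_to sp (series (fun n => w n *: glue (a n) (b n))) x.
Proof.
move=> ha hb; apply/converges_toP => eps eps0.
have [N1 h1] := ha _ eps0; have [N2 h2] := hb _ eps0.
exists (maxn N1 N2) => n; rewrite geq_max => /andP[/h1 l1 /h2 l2].
have e1 : sqnorm1 sp (series (fun n => w n *: glue (a n) (b n)) n - x) =
    sqnorm1 sp (\sum_(0 <= i < n) bc_of_complex (P1 (w i)) *: a i - x).
  rewrite -[LHS](bcnorm_idem1 spP) -[RHS](bcnorm_idem1 spP); congr (_ * bcnorm _ _ ^+ _).
  rewrite !scalerBr /series /= !scaler_sumr; congr (_ - _).
  by apply: eq_bigr => i _; exact: be1_scale_glue.
have e2 : sqnorm2 sp (series (fun n => w n *: glue (a n) (b n)) n - x) =
    sqnorm2 sp (\sum_(0 <= i < n) bc_of_complex (P2 (w i)) *: b i - x).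
  rewrite -[LHS](bcnorm_idem2 spP) -[RHS](bcnorm_idem2 spP); congr (_ * bcnorm _ _ ^+ _).
  rewrite !scalerBr /series /= !scaler_sumr; congr (_ - _).
  by apply: eq_bigr => i _; exact: be2_scale_glue.
have := bcnorm_sq spP (series (fun n => w n *: glue (a n) (b n)) n - x).
rewrite e1 e2; lra.
Qed.

End Gluing.

(** * Spectral theorem for bicomplex compact self-adjoint operators *)

Theorem theorem5p6 (R : realType) (M : lmodType (bicomplex R))
    (sp : M -> M -> bicomplex R) (hM : is_hilbert sp)
    (hsep : is_separable_infdim sp)
    (T : {linear M -> M}) (Tsa : self_adjoint sp T)
    (Tcompact : compact_operator sp T) :
  exists (psi : nat -> M) (lambda : nat -> bicomplex R),
    [/\ orthonormal_schauder_basis sp psi,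
        forall n : nat, is_eigenket T (lambda n) (psi n) &
        forall phi : M,
          converges_to sp
            (series (fun n : nat => (lambda n * sp (psi n) phi) *: psi n))
            (T phi)].
Proof.
have [spP _] := hM; have [sep1 inf1 sep2 inf2] := hsep.
have le1 x : sqnorm1 sp x <= 2 * bcnorm sp x ^+ 2.
  by rewrite bcnorm_sq// lerDl sqnorm2_ge0.
have le2 x : sqnorm2 sp x <= 2 * bcnorm sp x ^+ 2.
  by rewrite bcnorm_sq// lerDr sqnorm1_ge0.
have [a [mu [ona eiga lima]]] := component_eigenbasis hM (component1 R) le1
  (bcnorm_idem1 spP) sep1 inf1 Tsa Tcompact.
have [b [nu [onb eigb limb]]] := component_eigenbasis hM (component2 R) le2
  (bcnorm_idem2 spP) sep2 inf2 Tsa Tcompact.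
pose psi n := glue (a n) (b n); pose lambda n := glue_scalar (mu n) (nu n).
have on : orthonormal_ket sp psi by move=> n m; apply: sp_glue_eq.
have eig n : T (psi n) = lambda n *: psi n.
  (* The component equations are exact only after multiplication by e1 and e2, which together
     determine a ket. *)
  apply: ket_ext.
    by rewrite be1_scale_glue P1_glue_scalar -eiga -!linearZ be1_glue.
  by rewrite be2_scale_glue P2_glue_scalar -eigb -!linearZ be2_glue.
have basis phi : converges_to sp (series (fun n => sp (psi n) phi *: psi n)) phi.
  apply: glue_converges => // eps eps0.
    have [N hN] := lima phi eps eps0; exists N => n /hN h.
    by under eq_bigr do rewrite (P1_sp_glue spP).
  have [N hN] := limb phi eps eps0; exists N => n /hN h.
  by under eq_bigr do rewrite (P2_sp_glue spP).
exists psi, lambda; split.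
- by split=> // phi; exists (fun n => sp (psi n) phi); exact: basis.
- move=> n; split=> // psi0; have := on n n.
  by rewrite eqxx (proj2 (sp_definite spP _) psi0) => /eqP; rewrite eq_sym oner_eq0.
(* The series is the basis expansion of [T phi]: its coefficient is <T psi_n, phi>, and [lambda n]
   is fixed by [dagger3] since its components are real. *)
- move=> phi; rewrite (_ : (fun n => _) = (fun n => sp (psi n) (T phi) *: psi n)) //.
  by apply/funext => n; rewrite Tsa eig (sp_scalel spP) dagger_glue_scalar.
Qed.
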